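(* For every integer $n\ge 1$, $\log\log e_n \ge n-\log n-1$. Moreover, $\log\log e_n \le n-\log n + O(\log\log n)$ as $n\to\infty$.
   Context: All logarithms $\log$ are to base $2$. A delta-matroid $(E,\mathcal F)$ consists of a finite ground set $E$ and a non-empty collection $\mathcal F$ of subsets of $E$ (the feasible sets) satisfying the symmetric exchange axiom: for all $X,Y\in\mathcal F$ and every $e\in X\triangle Y$ there exists $f\in X\triangle Y$ (possibly $f=e$) with $X\triangle\{e,f\}\in\mathcal F$. A delta-matroid is even if all its feasible sets have cardinalities of the same parity. Let $e_n$ denote the number of labelled even delta-matroids with ground set $[n]=\{1,\dots,n\}$, i.e. the number of collections $\mathcal F$ of subsets of $[n]$ such that $([n],\mathcal F)$ is an even delta-matroid. *)

(* Defs.v *)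
From mathcomp Require Import all_boot.
From Stdlib Require Import Reals.
Set Implicit Arguments. Unset Strict Implicit. Unset Printing Implicit Defensive.

(* Ground set [n] is modelled by 'I_n = {0,...,n-1} (labelled objects). *)

Definition symdiff (n : nat) (X Y : {set 'I_n}) : {set 'I_n} :=
  (X :\: Y) :|: (Y :\: X).

Definition sym_exchange (n : nat) (F : {set {set 'I_n}}) : bool :=
  [forall X in F, forall Y in F, forall e in symdiff X Y,
     exists f in symdiff X Y, symdiff X [set e; f] \in F].

Definition is_delta_matroid (n : nat) (F : {set {set 'I_n}}) : bool :=
  (F != set0) && sym_exchange F.

Definition is_even_delta_matroid (n : nat) (F : {set {set 'I_n}}) : bool :=
  is_delta_matroid F && [forall X in F, forall Y in F, odd #|X| == odd #|Y|].

Definition e_count (n : nat) : nat :=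
  #|[set F : {set {set 'I_n}} | is_even_delta_matroid F]|.

Definition log2 (x : R) : R := (ln x / ln 2)%R.

(* Main.v *)
Require Import Defs.
From Stdlib Require Import Reals Lra Lia.
From mathcomp Require Import all_boot zify_ssreflect.

Delimit Scope R_scope with R.

Set Implicit Arguments. Unset Strict Implicit. Unset Printing Implicit Defensive.

(** Lower bound: removing from a parity class a family [M] that meets every
    [{Z + e | e}] in at most two members leaves an even delta-matroid, because
    feasible [X], [Y] at distance at least 4 leave at least three choices of [f].
    Colouring the subsets of [n] by xor-sums of labels, each label carried by at
    most two elements, yields such an [M] with at least [2^n / (2 n)] members, and
    every subfamily of [M] may be removed as well.

    Upper bound: if [X] is infeasible, the feasible sets at distance two from [X]
    form a matroid of rank at most two, hence are described by one of at most
    [(n+1)^n] codes.  By Cauchy-Schwarz on the cliques [{Z + e | e}], every large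
    family [U] has a member [X] whose ball of radius two meets [U] in at least
    [|U| n^2 / 2^(n+2)] sets.  A Kleitman-Winston recursion follows: either [X] is
    feasible and is dropped from [U], or its whole ball is decided at the price
    of one code.  It takes [O(2^n log n / n^2)] codes of [O(n log n)] bits each
    to bring [U] down to size [O(2^n / n)]. *)

(** * Symmetric difference and flips of single elements *)

Lemma card_set_ord n : #|{set 'I_n}| = 2 ^ n.
Proof. by rewrite -cardsT -powersetT card_powerset cardsT card_ord. Qed.

Lemma in_symdiff n (X Y : {set 'I_n}) i :
  (i \in symdiff X Y) = (i \in X) (+) (i \in Y).
Proof. by rewrite !inE; case: (i \in X); case: (i \in Y). Qed.

Lemma symdiffC n (X Y : {set 'I_n}) : symdiff X Y = symdiff Y X.
Proof. by apply/setP=> i; rewrite !in_symdiff addbC. Qed.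

Lemma symdiffA n (X Y Z : {set 'I_n}) :
  symdiff X (symdiff Y Z) = symdiff (symdiff X Y) Z.
Proof. by apply/setP=> i; rewrite !in_symdiff addbA. Qed.

Lemma symdiffK n (X Y : {set 'I_n}) : symdiff X (symdiff X Y) = Y.
Proof. by apply/setP=> i; rewrite !in_symdiff addKb. Qed.

Lemma symdiff_big_addb n (P : pred 'I_n) (X Y : {set 'I_n}) :
  \big[addb/false]_(i in symdiff X Y) P i =
  \big[addb/false]_(i in X) P i (+) \big[addb/false]_(i in Y) P i.
Proof.
rewrite big_mkcond [in RHS]big_mkcond [X in _ (+) X]big_mkcond -big_split /=.
apply: eq_bigr => i _; rewrite in_symdiff.
by case: (i \in X); case: (i \in Y); case: (P i).
Qed.

Lemma odd_card_big_addb n (X : {set 'I_n}) :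
  odd #|X| = \big[addb/false]_(i in X) true.
Proof. by rewrite -sum1_card (big_morph _ oddD (erefl : odd 0 = false)). Qed.

Lemma odd_card_symdiff n (X Y : {set 'I_n}) :
  odd #|symdiff X Y| = odd #|X| (+) odd #|Y|.
Proof. by rewrite !odd_card_big_addb symdiff_big_addb. Qed.

Definition flip n (e : 'I_n) (X : {set 'I_n}) := symdiff X [set e].

Lemma flipK n (e : 'I_n) : involutive (flip e).
Proof. by move=> X; rewrite /flip symdiffC [symdiff X _]symdiffC symdiffK. Qed.

Lemma flipC n (e f : 'I_n) X : flip e (flip f X) = flip f (flip e X).
Proof. by rewrite /flip -!symdiffA [symdiff [set f] _]symdiffC. Qed.

Lemma odd_card_flip n (e : 'I_n) X : odd #|flip e X| = ~~ odd #|X|.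
Proof. by rewrite odd_card_symdiff cards1 addbT. Qed.

Lemma symdiff_set2 n (X : {set 'I_n}) e f :
  e != f -> symdiff X [set e; f] = flip f (flip e X).
Proof.
move=> nef; rewrite /flip -symdiffA; congr symdiff.
apply/setP=> i; rewrite in_symdiff !inE.
by case: eqVneq => [->|//]; rewrite (negPf nef).
Qed.

(** * Lower bound *)

Definition parity_class n p := [set X : {set 'I_n} | odd #|X| == p].

(** If every [f] other than [e] fails, the sets [flip f (flip e X)] all lie in [M], so [symdiff X Y]
    has at most three elements. Its size is even, hence two, and then the remaining [f] leads to [Y]
    itself. *)
Lemma sym_exchange_setD n (p : bool) (M : {set {set 'I_n}}) :
  (forall Z, #|[set e | flip e Z \in M]| <= 2) ->
  sym_exchange (parity_class n p :\: M).
Proof.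
move=> M2; set F := _ :\: _.
apply/forallP=> X; apply/implyP=> XF; apply/forallP=> Y; apply/implyP=> YF.
apply/forallP=> e; apply/implyP=> eXY; apply/existsP.
have [f /andP[fXY fF]|noF] :=
    pickP [pred f | f \in symdiff X Y :\ e & flip f (flip e X) \in F].
  move: fXY; rewrite in_setD1 => /andP[nfe fXY]; exists f.
  by rewrite fXY symdiff_set2 // eq_sym.
have oddF W : W \in F -> odd #|W| = p by rewrite !inE => /andP[_ /eqP].
have sub : symdiff X Y :\ e \subset [set f | flip f (flip e X) \in M].
  apply/subsetP=> f fXY; have := noF f; rewrite /= fXY /= inE.
  have -> : flip f (flip e X) \in parity_class n p.
    by rewrite inE !odd_card_flip negbK (oddF X).
  by rewrite andbT => /negbFE; rewrite inE.
have := leq_trans (subset_leq_card sub) (M2 (flip e X)).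
have := odd_card_symdiff X Y; rewrite (oddF X) // (oddF Y) // addbb.
rewrite (cardsD1 e (symdiff X Y)) eXY.
case card1: #|_| => [|[|[|m]]] // _ _.
move/eqP/cards1P: card1 => [f deff].
have : f \in symdiff X Y :\ e by rewrite deff set11.
rewrite in_setD1 => /andP[nfe fXY].
have defXY : symdiff X Y = [set e; f] by rewrite -(setD1K eXY) deff.
by have := noF f; rewrite /= deff set11 -symdiff_set2 1?eq_sym // -defXY symdiffK YF.
Qed.

(** Distinct subfamilies of [A] leave distinct complements in the parity class. These are non-empty:
    for [Z] of the opposite parity, the [n > 2] sets [flip e Z] cannot all lie in [A]. *)
Lemma card_even_delta_matroid_ge n (p : bool) (A : {set {set 'I_n}}) :
  2 < n -> A \subset parity_class n p ->
  (forall Z, #|[set e | flip e Z \in A]| <= 2) -> 2 ^ #|A| <= e_count n.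
Proof.
move=> n3 sAP A2; rewrite -card_powerset.
have injF : {in powerset A &, injective (fun M => parity_class n p :\: M)}.
  move=> M M'; rewrite !inE => sM sM' eqF.
  have D (B : {set {set 'I_n}}) : B \subset A ->
      parity_class n p :\: (parity_class n p :\: B) = B.
    move=> sB; rewrite setDDr setDv set0U; apply/setIidPr.
    exact: subset_trans sB sAP.
  by rewrite -(D M) // eqF D.
rewrite -(card_in_imset injF); apply/subset_leq_card/subsetP=> _ /imsetP[M sMA ->].
rewrite inE in sMA.
rewrite inE /is_even_delta_matroid /is_delta_matroid.
apply/andP; split; last first.
  by do 2!(apply/forallP=> ?; apply/implyP; rewrite !inE => /andP[_ /eqP->]).
apply/andP; split; last first.
  apply: sym_exchange_setD => Z; apply: leq_trans (A2 Z).
  apply/subset_leq_card/subsetP=> e; rewrite !inE; exact: (subsetP sMA).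
have [Z oddZ] : exists Z : {set 'I_n}, odd #|Z| = ~~ p.
  case: p {sAP injF}; first by exists set0; rewrite cards0.
  by exists [set Ordinal n3]; rewrite cards1.
have: ~~ ([set: 'I_n] \subset [set e | flip e Z \in A]).
  apply/negP=> /subset_leq_card; rewrite cardsT card_ord => /leq_trans/(_ (A2 Z)).
  by rewrite leqNgt n3.
case/subsetPn=> e _; rewrite inE => eA; apply/set0Pn; exists (flip e Z).
rewrite !inE odd_card_flip oddZ negbK eqxx andbT.
by apply: contra eA; apply: (subsetP sMA).
Qed.

(** * A large family meeting each clique at most twice *)

Lemma card_fiber_ge (T G : finType) (c : T -> G) :
  0 < #|T| -> exists g, #|T| <= #|[set x | c x == g]| * #|G|.
Proof.
case/card_gt0P=> x0 _.
pose g := [arg max_(g > c x0) #|[set x | c x == g]|].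
exists g; rewrite -[leqLHS]sum1_card (partition_big c xpredT) //=.
apply: (@leq_trans (\sum_(h : G) #|[set x | c x == g]|)); last first.
  by rewrite sum_nat_const mulnC.
apply: leq_sum => h _; rewrite sum1dep_card.
by rewrite /g; case: arg_maxnP => // i _; apply.
Qed.

(** Halving the index lets two elements share a label, so [2 ^ k] labels serve [2 ^ k.+1] elements;
    within that range the default [set0] of [nth] is never reached. *)
Definition label n k (i : 'I_n) : {set 'I_k} := nth set0 (enum {set 'I_k}) i./2.

Lemma card_label_fiber n k (S : {set 'I_k}) :
  n <= 2 ^ k.+1 -> #|[set i : 'I_n | label k i == S]| <= 2.
Proof.
move=> nk; rewrite -card_bool.
have injo : {in [set i : 'I_n | label k i == S] &, injective (fun i : 'I_n => odd i)}.
  move=> i j; rewrite !inE => /eqP <- /eqP eqij oij; apply/val_inj => /=.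
  have sz (h : 'I_n) : h./2 < size (enum {set 'I_k}).
    rewrite -cardE card_set_ord -ltn_double; apply: leq_ltn_trans (leq_trans (ltn_ord h) _).
      by rewrite -{2}(odd_double_half h) leq_addl.
    by rewrite -mul2n -expnS.
  move/eqP: eqij; rewrite /label nth_uniq ?sz ?enum_uniq // => /eqP eqh.
  by rewrite -(odd_double_half i) -(odd_double_half j) oij eqh.
by rewrite -(card_in_imset injo) max_card.
Qed.

Definition colour n k (X : {set 'I_n}) : {set 'I_k} :=
  [set j | \big[addb/false]_(i in X) (j \in label k i)].

Lemma colour_flip n k (e : 'I_n) X :
  colour k (flip e X) = symdiff (colour k X) (label k e).
Proof.
by apply/setP=> j; rewrite in_symdiff !inE symdiff_big_addb big_set1.
Qed.

Lemma e_count_ge_exp n :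
  2 < n -> exists2 a, 2 ^ n <= a * (2 * n) & 2 ^ a <= e_count n.
Proof.
move=> n3; have n0 : 0 < n by apply: ltn_trans n3.
pose k := trunc_log 2 n; have /andP[kn nk] := trunc_log_bounds (isT : 1 < 2) n0.
have T0 : 0 < #|{set 'I_n}| by rewrite card_set_ord expn_gt0.
(* Pigeonhole over parity and colour: there are [2 * 2 ^ k <= 2 * n] classes. *)
have [[p S] leA] := card_fiber_ge (fun X : {set 'I_n} => (odd #|X|, colour k X)) T0.
set A := [set X | _] in leA; exists #|A|.
  move: leA; rewrite card_prod card_bool !card_set_ord => /leq_trans; apply.
  by rewrite !leq_mul2l /= kn orbT.
apply: (@card_even_delta_matroid_ge _ p) => // [|Z].
  by apply/subsetP=> X; rewrite !inE xpair_eqE => /andP[].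
(* If [flip e Z] has colour [S], the label of [e] is forced by [Z]. *)
apply: leq_trans (@card_label_fiber n k (symdiff (colour k Z) S) (ltnW nk)).
apply/subset_leq_card/subsetP=> e; rewrite !inE xpair_eqE colour_flip.
by case/andP=> _ /eqP<-; rewrite symdiffK.
Qed.

(** Ensures that the inner logarithm is at least 1, so that the outer one is taken of a positive
    number and is nonnegative. *)
Lemma e_count_ge2 n : 0 < n -> 2 <= e_count n.
Proof.
move=> n0; pose X := [set Ordinal n0].
have <- : #|[set [set set0]; [set X]]| = 2.
  rewrite cards2 (inj_eq set1_inj) eq_sym.
  by case: eqVneq => // /setP/(_ (Ordinal n0)); rewrite !inE eqxx.
apply/subset_leq_card/subsetP=> F; rewrite !inE.
have edm (W : {set 'I_n}) : is_even_delta_matroid [set W].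
  apply/andP; split; last first.
    by do 2!(apply/forallP=> ?; apply/implyP=> /set1P->).
  apply/andP; split; first by apply/set0Pn; exists W; rewrite set11.
  do 2!(apply/forallP=> ?; apply/implyP=> /set1P->).
  by apply/forallP=> e; rewrite in_symdiff addbb.
by case/orP=> /eqP->.
Qed.

(** * Upper bound *)

Definition ball2 n (X : {set 'I_n}) := [set flip e.2 (flip e.1 X) | e : 'I_n * 'I_n].

Lemma flip_flip_in_ball2 n e f (X : {set 'I_n}) : flip f (flip e X) \in ball2 X.
Proof. by apply/imsetP; exists (e, f). Qed.

Lemma ball2_refl n (X : {set 'I_n}) : 0 < n -> X \in ball2 X.
Proof. by move=> n0; rewrite -{1}(flipK (Ordinal n0) X) flip_flip_in_ball2. Qed.

Lemma sum_nat_Cauchy (T : finType) (a : T -> nat) :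
  (\sum_x a x) ^ 2 <= #|T| * \sum_x a x ^ 2.
Proof.
rewrite -(leq_pmul2l (isT : 0 < 2)) expnS expn1 big_distrlr /= big_distrr /=.
apply: (@leq_trans (\sum_x \sum_y (a x ^ 2 + a y ^ 2))).
  apply: leq_sum => x _; rewrite big_distrr /=.
  by apply: leq_sum => y _; apply: nat_Cauchy.
under eq_bigr do rewrite big_split /=.
rewrite big_split /= sum_nat_const.
under eq_bigr do rewrite sum_nat_const.
by rewrite -big_distrr /= mulSn mul1n.
Qed.

(* Double counting of the cliques [{flip e Z | e}], [Z] ranging over all sets. *)
Lemma sum_flip_pairs n (U : {set {set 'I_n}}) :
  n ^ 2 * #|U| ^ 2 <=
  2 ^ n * \sum_(X in U) #|[set e : 'I_n * 'I_n | flip e.2 (flip e.1 X) \in U]|.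
Proof.
pose a Z := \sum_(e < n) (flip e Z \in U).
have flipB e : bijective (@flip n e) by exists (flip e); apply: flipK.
have sum_a : \sum_Z a Z = n * #|U|.
  rewrite exchange_big /=; transitivity (\sum_(e < n) #|U|); last first.
    by rewrite sum_nat_const card_ord.
  apply: eq_bigr => e _.
  rewrite (reindex (flip e)) /=; last exact: onW_bij.
  under eq_bigr do rewrite flipK.
  by rewrite -sum1_card [RHS]big_mkcond.
rewrite -expnMn -sum_a -card_set_ord; apply: leq_trans (sum_nat_Cauchy a) _.
rewrite leq_mul2l; apply/orP; right; apply: eq_leq.
transitivity (\sum_Z \sum_(e < n) \sum_(f < n) ((flip e Z \in U) * (flip f Z \in U))).
  by apply: eq_bigr => Z _; rewrite expnS expn1 big_distrlr.
rewrite exchange_big /=.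
(* Substituting [Z = flip e X] turns two members of a clique into a member [X] of [U] and a set of
   its ball. *)
transitivity (\sum_(e < n) \sum_X \sum_(f < n) ((X \in U) * (flip f (flip e X) \in U))).
  apply: eq_bigr => e _; rewrite (reindex (flip e)) /=; last exact: onW_bij.
  by apply: eq_bigr => X _; apply: eq_bigr => f _; rewrite flipK.
rewrite exchange_big /= [RHS]big_mkcond; apply: eq_bigr => X _.
case: (X \in U); last by rewrite big1 // => e _; rewrite big1.
rewrite -sum1dep_card [RHS]big_mkcond /=.
rewrite -(pair_bigA _ (fun e f => if flip f (flip e X) \in U then 1 else 0)) /=.
by apply: eq_bigr => e _; apply: eq_bigr => f _; rewrite mul1n.
Qed.

(** The diagonal contributes at most [n] pairs. Off it, a set is reached from [X] only by the two
    orders of one pair, which the bit [e.1 < e.2] tells apart. *)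
Lemma card_flip_pairs n (U : {set {set 'I_n}}) X :
  #|[set e : 'I_n * 'I_n | flip e.2 (flip e.1 X) \in U]| <= n + 2 * #|ball2 X :&: U|.
Proof.
set P := [set e | _].
pose D := [set e : 'I_n * 'I_n | e.1 == e.2].
rewrite -(cardsID D P); apply: leq_add.
  apply: (@leq_trans #|[set (i, i) | i : 'I_n]|).
    apply/subset_leq_card/subsetP=> -[i j]; rewrite !inE /= => /andP[_ /eqP->].
    exact: imset_f.
  by apply: leq_trans (leq_imset_card _ _) _; rewrite card_ord.
pose h (e : 'I_n * 'I_n) := (e.1 < e.2, flip e.2 (flip e.1 X)).
have injh : {in P :\: D &, injective h}.
  move=> [i j] [i' j']; rewrite !inE /= => /andP[nij _] /andP[nij' _] [lt_eq].
  rewrite -!symdiff_set2 // => eqX.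
  have eqS : [set i; j] = [set i'; j'] by rewrite -(symdiffK X [set i; j]) eqX symdiffK.
  have : i \in [set i'; j'] by rewrite -eqS set21.
  have : j \in [set i'; j'] by rewrite -eqS set22.
  move: nij nij' lt_eq; rewrite !inE => nij nij' + /orP[]/eqP ej /orP[]/eqP ei.
  - by rewrite ei ej eqxx in nij.
  - rewrite ei ej => lt_eq; move: nij'; rewrite -val_eqE /=.
    by case: ltngtP lt_eq.
  - by rewrite ei ej.
  - by rewrite ei ej eqxx in nij.
rewrite -(card_in_imset injh) -card_bool -cardsT -cardsX.
apply/subset_leq_card/subsetP=> _ /imsetP[e + ->]; rewrite !inE => /andP[_ eP].
by rewrite flip_flip_in_ball2 eP.
Qed.

(** Averages [sum_flip_pairs] over [U]. The size assumed for [U] makes the diagonal term [2 ^ n * n]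
    at most half of [n ^ 2 * #|U|], which costs the extra factor two. *)
Lemma exists_dense_ball2 n (U : {set {set 'I_n}}) :
  0 < n -> 2 ^ n.+1 <= #|U| * n ->
  exists2 X, X \in U & #|U| * n ^ 2 <= #|ball2 X :&: U| * 2 ^ n.+2.
Proof.
move=> n0 leU; pose D X := #|[set e : 'I_n * 'I_n | flip e.2 (flip e.1 X) \in U]|.
have U0 : 0 < #|U| by case: #|U| leU => //; rewrite mul0n leqNgt expn_gt0.
have [X /andP[XU leX]|noX] := pickP [pred X in U | n ^ 2 * #|U| <= 2 ^ n * D X].
  exists X => //; have := card_flip_pairs U X; rewrite -/(D X) => leD.
  have := leq_trans leX (leq_mul (leqnn (2 ^ n)) leD).
  have : 2 ^ n.+1 * n <= #|U| * n * n by rewrite leq_mul2r leU orbT.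
  by rewrite !expnS expn0; nia.
have := sum_flip_pairs U; rewrite leqNgt => /negP[].
have -> : n ^ 2 * #|U| ^ 2 = \sum_(X in U) n ^ 2 * #|U|.
  by rewrite sum_nat_const expnS expn1 mulnCA.
rewrite big_distrr /=.
case/card_gt0P: (U0) => X0 X0U.
(* One term is split off to keep the inequality strict. *)
rewrite (bigD1 X0) //= [ltnRHS](bigD1 X0) //= -addSn; apply: leq_add.
  by have := noX X0; rewrite /= X0U /= => /negbT; rewrite -ltnNge.
apply: leq_sum => X /andP[XU _].
by have := noX X; rewrite /= XU /= => /negbT; rewrite -ltnNge => /ltnW.
Qed.

(** * Local structure around an infeasible set *)

Section Link.

Variables (n : nat) (F : {set {set 'I_n}}) (X : {set 'I_n}).
Hypotheses (edmF : is_even_delta_matroid F) (XF : X \notin F).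

Definition link (e : 'I_n) := [set f | flip f (flip e X) \in F].

Lemma link_sym e f : (f \in link e) = (e \in link f).
Proof. by rewrite !inE flipC. Qed.

Lemma link_irrefl e : e \notin link e.
Proof. by rewrite inE flipK. Qed.

Lemma even_parity A B : A \in F -> B \in F -> odd #|A| = odd #|B|.
Proof.
case/andP: edmF => _ /forallP/(_ A)/implyP h AF BF.
by move/forallP/(_ B)/implyP/(_ BF)/eqP: (h AF).
Qed.

(** Evenness excludes the choice [f = e], since a single flip changes parity. *)
Lemma exchange A B e : A \in F -> B \in F -> e \in symdiff A B ->
  exists2 f, f \in symdiff A B :\ e & flip f (flip e A) \in F.
Proof.
move=> AF BF eAB; case/andP: edmF => /andP[_ ex] _.
move/forallP/(_ A)/implyP/(_ AF)/forallP/(_ B)/implyP/(_ BF): ex.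
move/forallP/(_ e)/implyP/(_ eAB)/existsP=> [f /andP[fAB]].
have [<-|nef fF] := eqVneq e f; last first.
  by exists f; rewrite -?symdiff_set2 // in_setD1 eq_sym nef.
rewrite setUid -/(flip e A) => eF.
by have := even_parity AF eF; rewrite odd_card_flip; case: (odd #|A|).
Qed.

(* As [X] is infeasible, the pairs [{e, f}] with [X] flipped at [e] and [f]
   feasible are the bases of a matroid of rank at most two: nonadjacency is an
   equivalence relation on nonloops. *)
Lemma link_sub e f : link f != set0 -> f \notin link e -> link e \subset link f.
Proof.
case/set0Pn=> k kf nfe; apply/subsetP=> h he; apply: contraT => nhf.
have nfe' : e \notin link f by rewrite link_sym.
have neh : e != h by apply: contraTneq he => <-; apply: link_irrefl.
have nfk : f != k by apply: contraTneq kf => <-; apply: link_irrefl.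
have nek : e != k by apply: contraNneq nfe' => ->.
have nhk : h != k by apply: contraNneq nhf => ->.
have nef : e != f by apply: contraNneq nhf => <-.
have nhf' : h != f by apply: contraNneq nfe => <-.
have defD : symdiff (flip k (flip f X)) (flip h (flip e X)) =
            symdiff [set f; k] [set e; h].
  rewrite -!symdiff_set2 // [symdiff X [set f; k]]symdiffC -symdiffA.
  by rewrite symdiffK.
have kF : flip k (flip f X) \in F by rewrite inE in kf.
have hF : flip h (flip e X) \in F by rewrite inE in he.
have kD : k \in symdiff (flip k (flip f X)) (flip h (flip e X)).
  by rewrite defD in_symdiff !inE eqxx orbT eq_sym (negPf nek) eq_sym (negPf nhk).
have [j] := exchange kF hF kD; rewrite flipK defD in_setD1 in_symdiff !inE.
case/andP=> njk jD jF.
(* Exchanging [k] must give one of three sets: [X] itself, or one witnessing [e] or [h] in [link f].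
   All three are infeasible. *)
have : [|| j == f, j == e | j == h] by move: njk jD; do 4!case: eqP.
case/or3P=> /eqP ej; subst j.
- by rewrite flipK (negPf XF) in jF.
- by move: nfe'; rewrite inE jF.
- by move: nhf; rewrite inE jF.
Qed.

(** Loops get [None], and each other element a canonical representative of its parallel class, the
    elements with the same link. *)
Definition link_code : {ffun 'I_n -> option 'I_n} :=
  [ffun e => if link e == set0 then None else [pick e' | link e' == link e]].

Lemma link_codeP e f : (f \in link e) =
  [&& link_code e != None, link_code f != None & link_code e != link_code f].
Proof.
have codeN g : (link_code g != None) = (link g != set0).
  rewrite ffunE; case: (link g == set0) => //=; case: pickP => // /(_ g).
  by rewrite eqxx.
rewrite !codeN.
have [e0|eN0] := eqVneq (link e) set0; first by rewrite e0 inE.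
have [f0|fN0] := eqVneq (link f) set0; first by rewrite link_sym f0 inE.
rewrite /= !ffunE (negPf eN0) (negPf fN0).
have [fe|nfe] := boolP (f \in link e); symmetry; last first.
  have nef : e \notin link f by rewrite link_sym.
  have -> : link e = link f by apply/eqP; rewrite eqEsubset !link_sub.
  by rewrite eqxx.
case: pickP => [g /eqP eg|/(_ e)]; last by rewrite eqxx.
case: pickP => [g' /eqP eg'|/(_ f)]; last by rewrite eqxx.
apply/eqP=> -[gg']; have := link_irrefl f.
by rewrite -eg' -gg' eg fe.
Qed.

(** Independent of [F]: given [X], the code alone determines the infeasible sets in the ball. *)
Definition link_decode (g : {ffun 'I_n -> option 'I_n}) : {set {set 'I_n}} :=
  ball2 X :\: [set flip e.2 (flip e.1 X) | e : 'I_n * 'I_n &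
                 [&& g e.1 != None, g e.2 != None & g e.1 != g e.2]].

Lemma link_codeK : link_decode link_code = ~: F :&: ball2 X.
Proof.
apply/setP=> Y; rewrite in_setD in_setI in_setC andbC.
have [/imsetP[[e f] _ ->] /=|_] := boolP (Y \in ball2 X); last by rewrite andbF.
rewrite !andbT; congr (~~ _); apply/imsetP/idP => [[[i j]]|fF].
  by rewrite inE /= -link_codeP inE => ijF ->.
by exists (e, f); rewrite // inE /= -link_codeP inE.
Qed.

End Link.

(** * Recursion on traces *)

Lemma leq_expn2r m n e : m <= n -> m ^ e <= n ^ e.
Proof. by case: e => // e; rewrite leq_exp2r. Qed.

Definition traces (V : finType) (C : {set {set V}}) (U : {set V}) :=
  [set M :&: U | M in C].

Lemma card_traces_le (V : finType) (C : {set {set V}}) U :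
  #|traces C U| <= 2 ^ #|U|.
Proof.
rewrite -card_powerset; apply/subset_leq_card/subsetP=> _ /imsetP[M _ ->].
by rewrite inE subsetIr.
Qed.

(* A member of [C] avoiding [v] is determined on [U] by its trace on [U :\ v];
   one containing [v] by its traces on [N] and [U :\: N]. *)
Lemma card_traces_split (V : finType) (C : {set {set V}}) (U N : {set V}) v :
  #|traces C U| <= #|traces C (U :\ v)| +
    #|traces [set M in C | v \in M] N| * #|traces C (U :\: N)|.
Proof.
rewrite -(cardsID [set S : {set V} | v \notin S] (traces C U)); apply: leq_add.
  apply/subset_leq_card/subsetP=> S /setIP[/imsetP[M MC ->]]; rewrite inE => vM.
  apply/imsetP; exists M => //; apply/setP=> x; move: vM; rewrite !inE.
  by case: eqVneq => // ->; case: (v \in M) => //= /negPf.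
rewrite -cardsX.
set T := setX _ _.
apply: leq_trans (leq_imset_card (fun AB => AB.1 :&: U :|: AB.2) (mem T)).
apply/subset_leq_card/subsetP=> S /setDP[/imsetP[M MC ->]].
rewrite inE negbK => /setIP[vM vU].
apply/imsetP; exists (M :&: N, M :&: (U :\: N)).
  by rewrite inE /=; apply/andP; split; apply: imset_f; rewrite // inE MC.
apply/setP=> x; rewrite !inE.
by case: (x \in M); case: (x \in N); case: (x \in U).
Qed.

(* Every step either discards a vertex, or fixes the trace on a ball at the
   price of a factor [K] and of a proportion [a / b] of the remaining vertices. *)
Lemma card_traces_bound (V : finType) (C : {set {set V}}) (N : V -> {set V})
    (K u a b : nat) :
  0 < K -> 0 < b ->
  (forall v, v \in N v) ->
  (forall v, #|traces [set M in C | v \in M] (N v)| <= K) ->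
  (forall U : {set V}, u < #|U| -> exists2 v, v \in U & #|U| * a <= #|N v :&: U| * b) ->
  forall q (U : {set V}), #|U| * (b - a) ^ q <= u * b ^ q ->
  #|traces C U| <= 2 ^ u * (#|U|.+1 * K) ^ q.
Proof.
move=> K0 b0 Nv leK dense q U; have [m] := ubnP #|U|.
elim: m q U => // m IHm q U; rewrite ltnS => leUm leU.
have [leUu|ltuU] := leqP #|U| u.
  apply: leq_trans (card_traces_le C U) _; rewrite -[leqLHS]muln1.
  by rewrite leq_mul ?leq_pexp2l // expn_gt0 muln_gt0 K0.
case: q leU => [|q] leU.
  by move: leU; rewrite !expn0 !muln1 leqNgt ltuU.
have [v vU lev] := dense U ltuU.
have cardN := cardsID (N v) U; rewrite setIC in cardN.
have N0 : 0 < #|N v :&: U| by apply/card_gt0P; exists v; rewrite inE Nv.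
have cardv : #|U| = #|U :\ v|.+1 by rewrite (cardsD1 v) vU.
have T1 : #|traces C (U :\ v)| <= 2 ^ u * (#|U| * K) ^ q.+1.
  rewrite [in leqRHS]cardv; apply: IHm; first by rewrite -cardv.
  by apply: leq_trans leU; rewrite leq_mul2r cardv leqnSn orbT.
have T2 : #|traces C (U :\: N v)| <= 2 ^ u * (#|U| * K) ^ q.
  apply: (@leq_trans (2 ^ u * (#|U :\: N v|.+1 * K) ^ q)); last first.
    rewrite leq_mul2l leq_expn2r ?orbT // leq_mul2r -cardN.
    by rewrite -[X in X < _]add0n ltn_add2r N0 orbT.
  apply: IHm; first by apply: leq_trans leUm; rewrite -cardN -[X in X < _]add0n ltn_add2r.
  rewrite -(leq_pmul2r b0) -[leqRHS]mulnA -expnSr; apply: leq_trans leU.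
  rewrite expnS mulnA mulnAC leq_mul2r; apply/orP; right.
  by rewrite mulnBr -cardN mulnDl; move: lev; rewrite -cardN; nia.
apply: leq_trans (card_traces_split C U (N v) v) _.
apply: leq_trans (leq_add T1 (leq_mul (leK v) T2)) _.
(* With [s = #|U|], the branches add up to [(s K)^(q+1) + K (s K)^q = (s K)^q (s + 1) K]; this is
   why the bound carries [#|U|.+1]. *)
apply: (@leq_trans (2 ^ u * ((#|U| * K) ^ q * (#|U|.+1 * K)))).
  by rewrite [(_ * K) ^ q.+1]expnSr; nia.
by rewrite expnSr leq_mul2l leq_mul2r leq_expn2r ?orbT // leq_mul2r leqnSn orbT.
Qed.

(** Bernoulli's inequality for [1 + a / c], cleared of denominators. *)
Lemma expn_Bernoulli c a m : c ^ m * (c + m * a) <= c * (c + a) ^ m.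
Proof.
elim: m => [|m IHm]; first by rewrite mul0n addn0 !expn0 muln1 mul1n.
rewrite [(c + a) ^ _]expnSr mulnA; apply: (leq_trans _ (leq_mul IHm (leqnn (c + a)))).
by rewrite expnSr -!mulnA leq_mul2l; apply/orP; right; nia.
Qed.

(** Removing a proportion [a / b] at least [b / a] times halves the size. *)
Lemma double_expn_sub a b m : 0 < b -> a <= b -> b <= m * a -> 2 * (b - a) ^ m <= b ^ m.
Proof.
move=> b0 leab lebm; have [ba0|c0] := posnP (b - a).
  rewrite ba0; case: m lebm => [|m _]; last by rewrite exp0n // muln0.
  by rewrite mul0n leqNgt b0.
rewrite -(leq_pmul2l c0).
have := expn_Bernoulli (b - a) a m; rewrite subnK // => /(leq_trans _); apply.
by rewrite mulnA mulnC leq_mul2l; apply/orP; right; lia.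
Qed.

Lemma card_link_traces n (X : {set 'I_n}) :
  #|traces [set M in [set ~: F | F : {set {set 'I_n}} & is_even_delta_matroid F]
             | X \in M] (ball2 X)| <= n.+1 ^ n.
Proof.
have <- : #|{ffun 'I_n -> option 'I_n}| = n.+1 ^ n.
  by rewrite card_ffun card_option !card_ord.
apply: leq_trans (leq_imset_card (link_decode X) predT).
apply/subset_leq_card/subsetP=> _ /imsetP[M + ->]; rewrite inE.
case/andP=> /imsetP[F + ->]; rewrite !inE => edmF XF.
by rewrite -link_codeK // imset_f.
Qed.

Lemma sqrn_le_exp2 n : n ^ 2 <= 2 ^ n.+2.
Proof.
elim: n => // n; rewrite !expnS expn0; have := ltn_expl n (isT : 1 < 2); nia.
Qed.

(** Families are encoded by their complements. The recursion stops at [2 ^ n.+1 %/ n], below which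
    dense balls are no longer guaranteed. Each round of [(2 ^ n.+2 %/ n ^ 2).+1] codes halves what
    remains, and [k] rounds gain the factor [2 ^ k >= n]. *)
Lemma e_count_le n k : 0 < n -> n <= 2 ^ k ->
  e_count n <= 2 ^ (2 ^ n.+1 %/ n) *
    ((2 ^ n).+1 * n.+1 ^ n) ^ ((2 ^ n.+2 %/ n ^ 2).+1 * k).
Proof.
move=> n0 nk; set u := _ %/ n; set m := (_ %/ _).+1.
have cardS : #|[set: {set 'I_n}]| = 2 ^ n.
  by rewrite cardsT card_set_ord.
pose C := [set ~: F | F : {set {set 'I_n}} & is_even_delta_matroid F].
have -> : e_count n = #|traces C setT|.
  rewrite /e_count -(card_imset _ (@setC_inj _)); congr #|pred_of_set _|.
  apply/setP=> M; apply/imsetP/imsetP=> [[F + ->]|[_ /imsetP[F + ->] ->]].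
    by rewrite inE => edmF; exists (~: F); rewrite ?setIT // imset_f // inE.
  by rewrite inE => edmF; exists F; rewrite ?setIT // inE.
rewrite -cardS; apply: (@card_traces_bound _ _ (@ball2 n) _ _ (n ^ 2) (2 ^ n.+2)).
- by rewrite expn_gt0.
- by rewrite expn_gt0.
- by move=> X; apply: ball2_refl.
- exact: card_link_traces.
- move=> U; rewrite ltn_divLR // => ltU; apply: exists_dense_ball2 => //.
  exact: ltnW.
(* The factor two in the numerator of [u] absorbs the rounding, because [u + 1 <= 2 * u]. *)
have un : 2 ^ n <= u * n.
  have n2 : n <= 2 ^ n by apply/ltnW/ltn_expl.
  have u0 : 0 < u by rewrite divn_gt0 // (leq_trans n2) // leq_pexp2l.
  have := ltn_ceil (2 ^ n.+1) n0; rewrite -/u expnS; nia.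
have le2 : 2 * (2 ^ n.+2 - n ^ 2) ^ m <= (2 ^ n.+2) ^ m.
  apply: double_expn_sub (sqrn_le_exp2 n) _; first by rewrite expn_gt0.
  by apply/ltnW/ltn_ceil; rewrite expn_gt0 n0.
rewrite cardS !expnM; apply: (leq_trans (leq_mul un (leqnn _))).
apply: (@leq_trans (u * (2 ^ k * ((2 ^ n.+2 - n ^ 2) ^ m) ^ k))).
  by rewrite mulnA leq_mul2r leq_mul2l nk !orbT.
by rewrite -expnMn leq_mul2l leq_expn2r ?orbT.
Qed.

(** * Logarithms *)

Lemma ln2_gt0 : (0 < ln 2)%R.
Proof. by rewrite -ln_1; apply: ln_increasing; lra. Qed.

Lemma log2_le x y : (0 < x)%R -> (x <= y)%R -> (log2 x <= log2 y)%R.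
Proof.
move=> x0 [ltxy|->]; last by lra.
apply: Rmult_le_compat_r; first by left; apply/Rinv_0_lt_compat/ln2_gt0.
by left; apply: ln_increasing.
Qed.

Lemma log2_mul x y : (0 < x)%R -> (0 < y)%R -> log2 (x * y) = (log2 x + log2 y)%R.
Proof. by move=> x0 y0; rewrite /log2 ln_mult // /Rdiv Rmult_plus_distr_r. Qed.

Lemma log2_pow x n : (0 < x)%R -> log2 (x ^ n) = (INR n * log2 x)%R.
Proof. by move=> x0; rewrite /log2 ln_pow // /Rdiv Rmult_assoc. Qed.

Lemma log2_1 : log2 1 = 0%R.
Proof. by rewrite /log2 ln_1 /Rdiv Rmult_0_l. Qed.

Lemma log2_2 : log2 2 = 1%R.
Proof. by apply: Rinv_r; have := ln2_gt0; lra. Qed.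

Lemma log2_pow2 n : log2 (2 ^ n) = INR n.
Proof. by rewrite log2_pow ?log2_2; lra. Qed.

Lemma leq_INR m n : m <= n -> (INR m <= INR n)%R.
Proof. by move/leP; apply: le_INR. Qed.

Lemma INR_mul m n : INR (m * n) = (INR m * INR n)%R.
Proof. exact: mult_INR. Qed.

Lemma INR_expn m n : INR (m ^ n) = (INR m ^ n)%R.
Proof. by elim: n => // n IHn; rewrite expnS INR_mul IHn. Qed.

Lemma INR_gt0 n : 0 < n -> (0 < INR n)%R.
Proof. by move/ltP; apply: lt_0_INR. Qed.

Lemma log2_e_count_ge1 n : 0 < n -> (1 <= log2 (INR (e_count n)))%R.
Proof.
move=> n0; rewrite -log2_2; apply: log2_le; first by lra.
exact: (leq_INR (e_count_ge2 n0)).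
Qed.

Lemma e_count_lower n : 0 < n ->
  (INR n - log2 (INR n) - 1 <= log2 (log2 (INR (e_count n))))%R.
Proof.
move=> n0; have ge1 := log2_e_count_ge1 n0.
have [n2|n3] := leqP n 2.
  (* For [n] equal to 1 or 2 the left-hand side is 0. *)
  have : (log2 1 <= log2 (log2 (INR (e_count n))))%R by apply: log2_le; lra.
  rewrite log2_1.
  case: n n0 n2 {ge1} => [|[|[|n]]] // _ _ h.
    by rewrite [INR 1]/= log2_1; lra.
  by have -> : INR 2 = 2%R by []; rewrite log2_2; lra.
have [a le_a le_e] := e_count_ge_exp n3.
have le_ae : (INR a <= log2 (INR (e_count n)))%R.
  rewrite -log2_pow2; apply: log2_le; first by apply: pow_lt; lra.
  by have := leq_INR le_e; rewrite INR_expn.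
have a0 : 0 < a by case: a le_a {le_e le_ae} => //; rewrite mul0n leqNgt expn_gt0.
have := leq_INR le_a; rewrite INR_expn !INR_mul => le_a'.
have Ra := INR_gt0 a0; have Rn := INR_gt0 n0.
have p2 : (0 < INR 2 ^ n)%R by apply: pow_lt => /=; lra.
have := log2_le p2 le_a'; have -> : INR 2 = 2%R by [].
rewrite log2_pow2 log2_mul; [|lra|lra].
rewrite [log2 (2 * _)]log2_mul ?log2_2; [|lra|lra].
by have := log2_le Ra le_ae; lra.
Qed.

Lemma e_count_upper n : 4 <= n ->
  (log2 (log2 (INR (e_count n)))
     <= INR n - log2 (INR n) + 9 * log2 (log2 (INR n)))%R.
Proof.
move=> n4; have n0 : 0 < n by apply: leq_trans n4.
have R2 : INR 2 = 2%R by [].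
have Rn4 : (4 <= INR n)%R.
  by have := leq_INR n4; rewrite (_ : INR 4 = 4%R) //=; lra.
set P := (2 ^ n)%R; have P0 : (0 < P)%R by apply: pow_lt; lra.
set L := log2 (INR n).
have L2 : (2 <= L)%R.
  have -> : 2%R = log2 4 by rewrite (_ : 4%R = (2 ^ 2)%R) ?log2_pow2 //=; lra.
  by apply: log2_le; lra.
pose t := trunc_log 2 n; have /andP[tn nt] := trunc_log_bounds (isT : 1 < 2) n0.
have leu : (INR (2 ^ n.+1 %/ n) * INR n <= 2 * P)%R.
  have := leq_INR (leq_trunc_div (2 ^ n.+1) n).
  by rewrite INR_mul INR_expn R2.
set u := _ %/ n in leu.
have lem : (INR (2 ^ n.+2 %/ n ^ 2).+1 * INR n ^ 2 <= 8 * P)%R.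
  have : (2 ^ n.+2 %/ n ^ 2).+1 * n ^ 2 <= 2 ^ n.+3.
    have := leq_trunc_div (2 ^ n.+2) (n ^ 2); have := sqrn_le_exp2 n.
    by rewrite [2 ^ n.+3]expnS; lia.
  by move/leq_INR; rewrite INR_mul !INR_expn R2 /= -/P; lra.
set m := (_ %/ _).+1 in lem.
have lek : (INR t.+1 <= 2 * L)%R.
  have : (INR t <= L)%R.
    rewrite -log2_pow2; apply: log2_le; first by apply: pow_lt; lra.
    by have := leq_INR tn; rewrite INR_expn R2.
  by rewrite S_INR; lra.
set B := ((2 ^ n).+1 * n.+1 ^ n).
have B0 : (0 < INR B)%R by apply: INR_gt0; rewrite muln_gt0 expn_gt0.
have leB : (log2 (INR B) <= 4 * INR n * L)%R.
  have h1 : (log2 (INR (2 ^ n).+1) <= INR n + 1)%R.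
    rewrite -S_INR -(log2_pow2 n.+1); apply: log2_le; first exact: INR_gt0.
    have : (2 ^ n).+1 <= 2 ^ n.+1.
      by have := expn_gt0 2 n; rewrite expnS; lia.
    by move/leq_INR; rewrite [INR (2 ^ n.+1)]INR_expn R2.
  have h2 : (log2 (INR n.+1) <= 2 * L)%R.
    rewrite (_ : 2%R = INR 2) // -log2_pow; last by lra.
    apply: log2_le; first exact: INR_gt0.
    by rewrite S_INR /=; nra.
  rewrite INR_mul INR_expn log2_mul; [|exact: INR_gt0|by apply/pow_lt/INR_gt0].
  rewrite log2_pow; last exact: INR_gt0.
  have : (INR n * log2 (INR n.+1) <= INR n * (2 * L))%R.
    by apply: Rmult_le_compat_l => //; lra.
  by nra.
have lee : (log2 (INR (e_count n)) <= INR u + INR m * INR t.+1 * (4 * INR n * L))%R.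
  have := leq_INR (e_count_le n0 (ltnW nt)); rewrite -/u -/B -/t -/m.
  rewrite INR_mul !INR_expn R2 => lee.
  have e0 : (0 < INR (e_count n))%R by apply/INR_gt0/ltnW/e_count_ge2.
  apply: Rle_trans (log2_le e0 lee) _.
  rewrite log2_mul; [|by apply: pow_lt; lra|by apply: pow_lt].
  rewrite log2_pow2 log2_pow // INR_mul.
  apply: Rplus_le_compat_l; apply: Rmult_le_compat_l => //.
  by apply: Rmult_le_pos; apply: pos_INR.
have nL : (0 < INR n)%R by lra.
(* The terms amount to [2 P + 64 P L ^ 2]; 128 is the next convenient power of two. *)
have bound : (log2 (INR (e_count n)) * INR n <= 128 * (P * L ^ 2))%R.
  have h1 : (INR m * INR n ^ 2 * INR t.+1 * (4 * L) <= 8 * P * (2 * L) * (4 * L))%R.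
    apply: Rmult_le_compat_r; first by lra.
    apply: Rmult_le_compat => //; last exact: pos_INR.
    by apply: Rmult_le_pos; [exact: pos_INR|apply/pow_le; lra].
  have h2 : (P * 1 <= P * L ^ 2)%R.
    by apply: Rmult_le_compat_l; [lra|nra].
  have := Rmult_le_compat_r _ _ _ (Rlt_le _ _ nL) lee.
  by lra.
have le1 := log2_e_count_ge1 n0.
have LL1 : (1 <= log2 L)%R by rewrite -log2_2; apply: log2_le; lra.
have pos : (0 < log2 (INR (e_count n)) * INR n)%R by apply: Rmult_lt_0_compat; lra.
(* The constant 9 is 7 from [128 = 2 ^ 7], as [log2 L >= 1], plus 2 from [L ^ 2]. *)
have := log2_le pos bound; rewrite log2_mul; [|lra|lra].
have L20 : (0 < L ^ 2)%R by apply: pow_lt; lra.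
rewrite log2_mul; [|lra|exact: Rmult_lt_0_compat].
rewrite log2_mul // log2_pow2 log2_pow; last by lra.
rewrite (_ : 128%R = (2 ^ 7)%R) ?log2_pow2; last by rewrite /=; lra.
rewrite -/L.
by rewrite /=; lra.
Qed.

Theorem theorem3 :
  (forall n : nat, (1 <= n)%nat ->
     (log2 (log2 (INR (e_count n))) >= INR n - log2 (INR n) - 1)%R) /\
  (exists (C : R) (N : nat), forall n : nat, (N <= n)%nat ->
     (log2 (log2 (INR (e_count n)))
        <= INR n - log2 (INR n) + C * log2 (log2 (INR n)))%R).
Proof.
split; first by move=> n n1; apply/Rle_ge/e_count_lower.
by exists 9%R, 4 => n; apply: e_count_upper.
Qed.
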